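(* The assignment $\mathcal{U}$, which is the identity on objects and sends a monotone relation $r$ from $PX$ to $Y$ to the map $\mathcal{U}(r):Y\to UX$, is an equivalence of categories $\mathcal{U}:\mathsf{MRel}^{\mathrm{op}}\to\mathsf{Set}_{\mathbb{U}}$. Moreover, $\mathcal{U}(r)\le\mathcal{U}(r')\iff r\subseteq r'$, for all sets $X,Y$ and all monotone relations $r,r'$ from $PX$ to $Y$.
   Context: $PX$ denotes the powerset of $X$. For relations $r$ from $X$ to $Y$ and $s$ from $Y$ to $Z$, $s\cdot r$ is the usual relational composite: $x\,(s\cdot r)\,z$ iff there is $y\in Y$ with $x\,r\,y$ and $y\,s\,z$. For a function $f:X\to Y$, $f^\circ$ is the relation from $Y$ to $X$ with $y\,f^\circ\,x$ iff $f(x)=y$. For a relation $r$ from $X$ to $Y$, $\hat{P}r$ is the relation from $PX$ to $PY$ with $A\,(\hat{P}r)\,B$ iff for all $y\in B$ there is $x\in A$ with $x\,r\,y$. Let $m_X:PPX\to PX$, $\mathcal{A}\mapsto\bigcup\mathcal{A}$. A relation $r$ from $PX$ to $Y$ is monotone if $A\,r\,y$ and $A\subseteq B$ imply $B\,r\,y$. $\mathsf{MRel}$ is the category whose objects are sets, whose morphisms from $X$ to $Y$ are the monotone relations from $PX$ to $Y$, whose composition (for $r$ from $PX$ to $Y$ and $s$ from $PY$ to $Z$) is $s\circ r:=s\cdot(\hat{P}r)\cdot m_X^\circ$, and whose identity on $X$ is $\Delta_X$, given by $A\,\Delta_X\,x$ iff $x\in A$. The up-set functor $U:\mathsf{Set}\to\mathsf{Set}$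 sends $X$ to $UX=\{\mathcal{A}\subseteq PX\mid\mathcal{A}\text{ is up-closed}\}$ (up-closed: $A\in\mathcal{A}$ and $A\subseteq B\subseteq X$ imply $B\in\mathcal{A}$) and $f:X\to Y$ to $Uf:UX\to UY$, $Uf(\mathcal{A})=\{B\subseteq Y\mid f^{-1}(B)\in\mathcal{A}\}$. It is part of a monad $\mathbb{U}$ with unit $\eta_X:X\to UX$, $\eta_X(x)=\{A\subseteq X\mid x\in A\}$, and multiplication $\mu_X:UUX\to UX$, $\mu_X(\mathfrak{A})=\{A\subseteq X\mid A^\#\in\mathfrak{A}\}$, where $A^\#=\{\mathcal{A}\in UX\mid A\in\mathcal{A}\}$. The Kleisli category $\mathsf{Set}_{\mathbb{U}}$ has sets as objects; a morphism from $Y$ to $X$ is a map $\rho:Y\to UX$; the composite of $\sigma:Z\to UY$ with $\rho:Y\to UX$ is $\rho*\sigma:=\mu_X\cdot U\rho\cdot\sigma:Z\to UX$; the identity on $X$ is $\eta_X$. For $\rho,\rho':Y\to UX$ put $\rho\le\rho'$ iff $\rho(y)\subseteq\rho'(y)$ for all $y\in Y$. For a monotone relation $r$ from $PX$ to $Y$, $\mathcal{U}(r):Y\to UX$ is the map $y\mapsto\{A\subseteq X\mid A\,r\,y\}$. *)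

(* Defs.v *)
From mathcomp Require Import all_boot.
From mathcomp Require Import boolp classical_sets.
Set Implicit Arguments.
Unset Strict Implicit.
Unset Printing Implicit Defensive.

Local Open Scope classical_set_scope.

Record category := Category {
  ob :> Type;
  hom : ob -> ob -> Type;
  idm : forall X, hom X X;
  comp : forall X Y Z, hom Y Z -> hom X Y -> hom X Z;
  comp_idl : forall X Y (f : hom X Y), comp (idm Y) f = f;
  comp_idr : forall X Y (f : hom X Y), comp f (idm X) = f;
  comp_assoc : forall W X Y Z (f : hom W X) (g : hom X Y) (h : hom Y Z),
    comp h (comp g f) = comp (comp h g) f }.

Arguments hom {c} X Y.
Arguments idm {c} X.
Arguments comp {c X Y Z} g f.

Definition op (C : category) : category :=
  @Category C (fun X Y => @hom C Y X) (@idm C)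
    (fun X Y Z g f => comp f g)
    (fun X Y f => comp_idr f) (fun X Y f => comp_idl f)
    (fun W X Y Z f g h => esym (comp_assoc h g f)).

(* The data of a functor only, so that functoriality is a proposition about
   an assignment on objects and morphisms. *)
Record assignment (C D : category) := Assignment {
  fob :> C -> D;
  fmap : forall X Y : C, hom X Y -> hom (fob X) (fob Y) }.

Arguments fmap {C D} F {X Y} f : rename.

Definition is_functor (C D : category) (F : assignment C D) : Prop :=
  (forall X : C, fmap F (idm X) = idm (F X)) /\
  (forall (X Y Z : C) (g : hom Y Z) (f : hom X Y),
     fmap F (comp g f) = comp (fmap F g) (fmap F f)).

Definition idA (C : category) : assignment C C :=
  Assignment (fun (X Y : C) (f : hom X Y) => f).

Definition compA (C D E : category) (G : assignment D E) (F : assignment C D) :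
    assignment C E :=
  @Assignment C E (fun X => G (F X)) (fun X Y f => fmap G (fmap F f)).

Definition natural (C D : category) (F G : assignment C D)
    (a : forall X : C, hom (F X) (G X)) : Prop :=
  forall (X Y : C) (f : hom X Y), comp (fmap G f) (a X) = comp (a Y) (fmap F f).

Definition is_iso (C : category) (X Y : C) (f : hom X Y) : Prop :=
  exists g : hom Y X, comp g f = idm X /\ comp f g = idm Y.

Definition naturally_isomorphic (C D : category) (F G : assignment C D) : Prop :=
  exists a : forall X : C, hom (F X) (G X),
    natural a /\ forall X : C, is_iso (a X).

Definition is_equivalence (C D : category) (F : assignment C D) : Prop :=
  is_functor F /\
  exists G : assignment D C,
    [/\ is_functor G, naturally_isomorphic (compA G F) (idA C) &
        naturally_isomorphic (compA F G) (idA D)].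

Record monad (C : category) := Monad {
  mfun :> assignment C C;
  mfunP : is_functor mfun;
  unit : forall X : C, hom X (mfun X);
  mult : forall X : C, hom (mfun (mfun X)) (mfun X);
  unit_nat : @natural C C (idA C) mfun unit;
  mult_nat : @natural C C (compA mfun mfun) mfun mult;
  mult_unitl : forall X, comp (mult X) (unit (mfun X)) = idm (mfun X);
  mult_unitr : forall X, comp (mult X) (fmap mfun (unit X)) = idm (mfun X);
  mult_assoc : forall X,
    comp (mult X) (mult (mfun X)) = comp (mult X) (fmap mfun (mult X)) }.

Section Kleisli.
Variables (C : category) (T : monad C).

Definition khom (Y X : C) := hom Y (T X).

Definition kcomp (Z Y X : C) (rho : khom Y X) (sigma : khom Z Y) : khom Z X :=
  comp (mult T X) (comp (fmap T rho) sigma).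

Lemma kcomp_idl X Y (f : khom X Y) : kcomp (unit T Y) f = f.
Proof. by rewrite /kcomp comp_assoc mult_unitr comp_idl. Qed.

Lemma kcomp_idr X Y (f : khom X Y) : kcomp f (unit T X) = f.
Proof.
by rewrite /kcomp (unit_nat T f) comp_assoc mult_unitl comp_idl.
Qed.

Lemma kcomp_assoc W X Y Z (f : khom W X) (g : khom X Y) (h : khom Y Z) :
  kcomp h (kcomp g f) = kcomp (kcomp h g) f.
Proof.
have [_ mapC] := mfunP T.
rewrite /kcomp !mapC !comp_assoc -mult_assoc -!comp_assoc.
congr (comp _ _); rewrite !comp_assoc; congr (comp (comp _ _) _).
exact: (mult_nat T h).
Qed.

Definition kleisli : category :=
  @Category C khom (unit T) kcomp kcomp_idl kcomp_idr kcomp_assoc.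

End Kleisli.

Definition SET : category :=
  @Category Type (fun X Y => X -> Y) (fun X x => x)
    (fun X Y Z g f x => g (f x))
    (fun X Y f => erefl) (fun X Y f => erefl) (fun W X Y Z f g h => erefl).

(* Relations from [X] to [Y] are subsets of [X * Y]; the composite "first [r],
   then [s]" is [s \; r] of [relation_scope]. *)

Definition converse (X Y : Type) (f : X -> Y) : set (Y * X) :=
  [set yx | f yx.2 = yx.1].

Definition Phat (X Y : Type) (r : set (X * Y)) : set (set X * set Y) :=
  [set AB | forall y, AB.2 y -> exists2 x, AB.1 x & r (x, y)].

Definition unionP (X : Type) (F : set (set X)) : set X := \bigcup_(A in F) A.

Definition monotone (X Y : Type) (r : set (set X * Y)) : Prop :=
  forall (A B : set X) (y : Y), r (A, y) -> A `<=` B -> r (B, y).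

Record mrel (X Y : Type) :=
  MRelation { mrel_rel :> set (set X * Y); mrelP : monotone mrel_rel }.

Lemma mrel_eq (X Y : Type) (r s : mrel X Y) :
  (forall A y, mrel_rel r (A, y) <-> mrel_rel s (A, y)) -> r = s.
Proof.
case: r s => [r rP] [s sP] /= rs.
have E : r = s by apply/seteqP; split=> -[A y] /rs.
by case: s / E sP {rs} => sP; congr MRelation; exact: Prop_irrelevance.
Qed.

Definition mrel_comp_rel (X Y Z : Type) (s : set (set Y * Z))
    (r : set (set X * Y)) : set (set X * Z) :=
  ((s \; Phat r) \; converse (@unionP X))%relation.

Lemma mrel_comp_relE (X Y Z : Type) (s : mrel Y Z) (r : mrel X Y) A z :
  mrel_comp_rel s r (A, z) <-> mrel_rel s ([set y | mrel_rel r (A, y)], z).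
Proof.
split=> [[F /= FA] [B /= FB sB]|sA].
  rewrite /converse /= in FA; apply: (mrelP sB) => y /FB [A' FA' rA'] /=.
  by apply: (mrelP rA') => x A'x; rewrite -FA; exists A'.
exists [set A]; first by rewrite /converse /= /unionP bigcup_set1.
by exists [set y | mrel_rel r (A, y)] => //= y rAy; exists A.
Qed.

Lemma mrel_comp_monotone (X Y Z : Type) (s : mrel Y Z) (r : mrel X Y) :
  monotone (mrel_comp_rel s r).
Proof.
move=> A B z /mrel_comp_relE sA AB; apply/mrel_comp_relE.
by apply: (mrelP sA) => y /= rA; exact: (mrelP rA).
Qed.

Definition mrel_comp (X Y Z : Type) (s : mrel Y Z) (r : mrel X Y) : mrel X Z :=
  MRelation (@mrel_comp_monotone X Y Z s r).

Definition delta_rel (X : Type) : set (set X * X) := [set Ax | Ax.1 Ax.2].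

Lemma delta_monotone (X : Type) : monotone (@delta_rel X).
Proof. by move=> A B x /= Ax; exact. Qed.

Definition delta (X : Type) : mrel X X := MRelation (@delta_monotone X).

Lemma mrel_comp_idl X Y (r : mrel X Y) : mrel_comp (delta Y) r = r.
Proof. by apply: mrel_eq => A y; exact: mrel_comp_relE. Qed.

Lemma mrel_comp_idr X Y (r : mrel X Y) : mrel_comp r (delta X) = r.
Proof. by apply: mrel_eq => A y; exact: mrel_comp_relE. Qed.

Lemma mrel_comp_assoc W X Y Z (f : mrel W X) (g : mrel X Y) (h : mrel Y Z) :
  mrel_comp h (mrel_comp g f) = mrel_comp (mrel_comp h g) f.
Proof.
have compE U V T (p : mrel V T) (q : mrel U V) A z :
    mrel_rel (mrel_comp p q) (A, z)
    = mrel_rel p ([set y | mrel_rel q (A, y)], z).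
  by apply/propext; exact: mrel_comp_relE.
apply: mrel_eq => A z; rewrite !compE.
by have -> : [set y | mrel_rel (mrel_comp g f) (A, y)] =
             [set y | mrel_rel g ([set x | mrel_rel f (A, x)], y)]
  by apply/funext => y; rewrite /mkset compE.
Qed.

Definition MRel : category :=
  @Category SET mrel delta mrel_comp mrel_comp_idl mrel_comp_idr
    mrel_comp_assoc.

Definition up_closed (X : Type) (F : set (set X)) : Prop :=
  forall A B : set X, F A -> A `<=` B -> F B.

Record upset (X : Type) :=
  Upset { upset_set :> set (set X); upsetP : up_closed upset_set }.

Lemma upset_eq (X : Type) (F G : upset X) : (forall A, upset_set F A <-> upset_set G A) -> F = G.
Proof.
case: F G => [F FP] [G GP] /= FG.
have E : F = G by apply/seteqP; split=> A /FG.
by case: G / E GP {FG} => GP; congr Upset; exact: Prop_irrelevance.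
Qed.

Lemma up_map_closed (X Y : Type) (f : X -> Y) (F : upset X) :
  up_closed [set B | upset_set F (f @^-1` B)].
Proof. by move=> A B /= FA AB; apply: (upsetP FA) => x; exact: AB. Qed.

Definition up_map (X Y : Type) (f : X -> Y) (F : upset X) : upset Y :=
  Upset (@up_map_closed X Y f F).

Lemma up_unit_closed (X : Type) (x : X) : up_closed [set A : set X | A x].
Proof. by move=> A B /= Ax; exact. Qed.

Definition up_unit (X : Type) (x : X) : upset X := Upset (@up_unit_closed X x).

Definition sharp (X : Type) (A : set X) : set (upset X) :=
  [set F : upset X | upset_set F A].

Lemma up_mult_closed (X : Type) (FF : upset (upset X)) :
  up_closed [set A | upset_set FF (sharp A)].
Proof.
by move=> A B /= FA AB; apply: (upsetP FA) => F /upsetP; exact.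
Qed.

Definition up_mult (X : Type) (FF : upset (upset X)) : upset X :=
  Upset (@up_mult_closed X FF).

Definition up_functor : assignment SET SET :=
  @Assignment SET SET upset up_map.

Lemma up_functorP : is_functor up_functor.
Proof. by split=> [X|X Y Z g f]; apply/funext => F; exact: upset_eq. Qed.

Lemma up_unit_nat : @natural SET SET (idA SET) up_functor up_unit.
Proof. by move=> X Y f; apply/funext => x; exact: upset_eq. Qed.

Lemma up_mult_nat :
  @natural SET SET (compA up_functor up_functor) up_functor up_mult.
Proof. by move=> X Y f; apply/funext => x; exact: upset_eq. Qed.

Lemma up_mult_unitl (X : SET) :
  @comp SET _ _ _ (up_mult (X := X)) (up_unit (X := upset X)) = @idm SET (upset X).
Proof. by apply/funext => x; exact: upset_eq. Qed.

Lemma up_mult_unitr (X : SET) :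
  @comp SET _ _ _ (up_mult (X := X)) (fmap up_functor (up_unit (X := X)))
    = @idm SET (upset X).
Proof. by apply/funext => x; exact: upset_eq. Qed.

Lemma up_mult_assoc (X : SET) :
  @comp SET _ _ _ (up_mult (X := X)) (up_mult (X := upset X))
    = @comp SET _ _ _ (up_mult (X := X)) (fmap up_functor (up_mult (X := X))).
Proof. by apply/funext => x; exact: upset_eq. Qed.

Definition UpMonad : monad SET :=
  @Monad SET up_functor up_functorP up_unit up_mult up_unit_nat up_mult_nat
    up_mult_unitl up_mult_unitr up_mult_assoc.

Definition SetU : category := kleisli UpMonad.

Definition kle (X Y : Type) (rho rho' : Y -> upset X) : Prop :=
  forall y : Y, rho y `<=` rho' y.

Lemma calU_closed (X Y : Type) (r : mrel X Y) (y : Y) :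
  up_closed [set A | mrel_rel r (A, y)].
Proof. by move=> A B /= rA; exact: (mrelP rA). Qed.

Definition calU_hom (X Y : Type) (r : mrel X Y) (y : Y) : upset X :=
  Upset (@calU_closed X Y r y).

(* A morphism from [Y] to [X] in [op MRel] is a monotone relation from [set X]
   to [Y]. *)
Definition calU : assignment (op MRel) SetU :=
  @Assignment (op MRel) SetU (fun X => X) (fun Y X (r : mrel X Y) => calU_hom r).

(* Main.v *)
Require Import Defs.
From mathcomp Require Import all_boot.
From mathcomp Require Import boolp classical_sets.
Set Implicit Arguments.
Unset Strict Implicit.

Local Open Scope classical_set_scope.

(** A relation from [set X] to [Y] is the same thing as a family, indexed by
    [Y], of sets of subsets of [X], and it is monotone exactly when every member
    of the family is up-closed.  Hence [calU] is bijective on morphisms and the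
    identity on objects, and the inverse bijections make up an assignment
    [relU] with both composites equal to an identity assignment; inclusions
    correspond for the same reason.

    What has content is that [calU] respects composition.  By
    [mrel_comp_relE], the composite of [r] and [s] relates [A] to [z] iff [s]
    relates [[set y | r (A, y)]] to [z]: the converse of the union map lets one
    cover [A] by a family of sets, but monotonicity makes the family [[set A]]
    as good as any other.  On the Kleisli side, [A] lies in the composite at
    [z] iff the preimage of [sharp A] under [calU_hom r] lies in
    [calU_hom s z], and that preimage is again [[set y | r (A, y)]]. *)

Lemma naturally_isomorphic_refl (C D : category) (F : assignment C D) :
  naturally_isomorphic F F.
Proof.
exists (fun X => idm (F X)); split=> [X Y f|X]; first by rewrite comp_idl comp_idr.
by exists (idm (F X)); rewrite comp_idl.
Qed.

Lemma inverse_functors_equivalence (C D : category) (F : assignment C D)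
    (G : assignment D C) :
  is_functor F -> is_functor G ->
  Defs.compA G F = idA C -> Defs.compA F G = idA D -> is_equivalence F.
Proof.
move=> FP GP GF FG; split=> //; exists G.
by rewrite GF FG; split=> //; exact: naturally_isomorphic_refl.
Qed.

Lemma calU_functor : is_functor calU.
Proof.
split=> [X|X Y Z g f]; first by apply/funext => x; exact: upset_eq.
apply/funext => z; apply: upset_eq => A; exact: mrel_comp_relE.
Qed.

Lemma relU_monotone (X Y : Type) (rho : Y -> upset X) :
  monotone [set Ay : set X * Y | upset_set (rho Ay.2) Ay.1].
Proof. by move=> A B y /=; exact: upsetP. Qed.

Definition relU_hom (X Y : Type) (rho : Y -> upset X) : mrel X Y :=
  MRelation (@relU_monotone X Y rho).

Definition relU : assignment SetU (op MRel) :=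
  @Assignment SetU (op MRel) (fun X => X)
    (fun Y X (rho : Y -> upset X) => relU_hom rho).

Lemma calU_homK (X Y : Type) (r : mrel X Y) : relU_hom (calU_hom r) = r.
Proof. exact: mrel_eq. Qed.

Lemma relU_homK (X Y : Type) (rho : Y -> upset X) :
  calU_hom (relU_hom rho) = rho.
Proof. by apply/funext => y; exact: upset_eq. Qed.

(** Since [calU_hom] is injective, it suffices to compare images under it, and
    there the equation is the functoriality of [calU]. *)
Lemma relU_functor : is_functor relU.
Proof.
have [calU1 calUM] := calU_functor.
split=> [X|X Y Z g f]; first by rewrite -calU1; exact: calU_homK.
rewrite -[LHS]calU_homK -[RHS]calU_homK; congr relU_hom.
rewrite relU_homK.
have := calUM X Y Z (fmap relU g) (fmap relU f).
by rewrite /= !relU_homK.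
Qed.

(** Both composites act on objects as the identity by computation, so that
    equality of assignments reduces to equality of the maps on morphisms. *)
Lemma relU_calU : Defs.compA relU calU = idA (op MRel).
Proof.
congr Assignment.
apply/functional_extensionality_dep => Y.
apply/functional_extensionality_dep => X.
by apply/funext => r; exact: calU_homK.
Qed.

Lemma calU_relU : Defs.compA calU relU = idA SetU.
Proof.
congr Assignment.
apply/functional_extensionality_dep => Y.
apply/functional_extensionality_dep => X.
by apply/funext => rho; exact: relU_homK.
Qed.

Lemma kle_calU_hom (X Y : Type) (r r' : mrel X Y) :
  kle (calU_hom r) (calU_hom r') <-> r `<=` r'.
Proof. by split=> [rr' [A y]|rr' y A]; exact: rr'. Qed.

Theorem proposition10 :
  is_equivalence calU /\
  forall (X Y : MRel) (r r' : mrel X Y),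
    kle (calU_hom r) (calU_hom r') <-> r `<=` r'.
Proof.
split; last exact: kle_calU_hom.
exact: inverse_functors_equivalence calU_functor relU_functor relU_calU calU_relU.
Qed.
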